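(* Let $(A,(G_I,G_T))$ be a contract over types $\mathsf{state}$ and $\mathsf{input}$. If there exists a natural number $n \ge 0$ such that both $\mathsf{BaseCheck}(n)$ and $\mathsf{ExtendCheck}(n)$ hold, then the contract $(A,(G_I,G_T))$ is realizable.
   Context: Fix types (sets) $\mathsf{state}$ and $\mathsf{input}$; $s, s', s_j$ range over states and $i, i_j$ over inputs. No finiteness or decidability is assumed. A transition system is a pair $(I,T)$ of predicates $I$ on $\mathsf{state}$ (initial states) and $T$ on $\mathsf{state}\times\mathsf{input}\times\mathsf{state}$ (transitions; $T(s,i,s')$ means the system can move from $s$ to $s'$ on input $i$). A contract is a pair $(A,(G_I,G_T))$ where $A$ is a predicate on $\mathsf{state}\times\mathsf{input}$ (assumption), $G_I$ a predicate on $\mathsf{state}$ (initial guarantee), and $G_T$ a predicate on $\mathsf{state}\times\mathsf{input}\times\mathsf{state}$ (transitional guarantee). Given $(I,T)$ and $A$, the predicate $\mathsf{Reachable}_A$ on states is defined inductively (the least predicate) by $$\mathsf{Reachable}_A(s) = I(s) \lor \exists s_{p}, i.\ \mathsf{Reachable}_A(s_{p}) \land A(s_{p}, i) \land T(s_{p}, i, s).$$ A transition system $(I,T)$ is a realization of $(A,(G_I,G_T))$ when all of the following hold: 1. $\forall s.\ I(s) \Rightarrow G_I(s)$; 2. $\forall s,i,s'.\ \mathsf{Reachable}_A(s) \land A(s,i) \land T(s,i,s') \Rightarrow G_T(s,i,s')$; 3. $\exists s.\ I(s)$; 4. $\forall s,i.\ \mathsf{Reachable}_A(s) \land A(s,i)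 \Rightarrow \exists s'.\ T(s,i,s')$. A contract is realizable if there exists a transition system (over the same types) which is a realization of it. Finite viability: $\mathsf{Viable}_0(s)$ holds for every $s$, and $\mathsf{Viable}_{n}(s)$ is the formula $$\forall i_1.\ A(s,i_1) \Rightarrow \exists s_1.\ G_T(s,i_1,s_1) \land \bigl(\forall i_2.\ A(s_1,i_2) \Rightarrow \exists s_2.\ G_T(s_1,i_2,s_2) \land \cdots \land (\forall i_n.\ A(s_{n-1},i_n) \Rightarrow \exists s_n.\ G_T(s_{n-1},i_n,s_n))\cdots\bigr),$$ i.e. $\mathsf{Viable}_{n+1}(s) = \forall i.\ A(s,i) \Rightarrow \exists s'.\ G_T(s,i,s') \land \mathsf{Viable}_n(s')$. One-step extension: $\mathsf{Extend}_n(s)$ is the statement that any valid path of length $n$ from $s$ can be extended in response to any valid input: $$\forall i_1,s_1,\ldots,i_n,s_n.\ \bigl(A(s,i_1)\land G_T(s,i_1,s_1)\land\cdots\land A(s_{n-1},i_n)\land G_T(s_{n-1},i_n,s_n)\bigr) \Rightarrow \forall i.\ A(s_n,i)\Rightarrow \exists s'.\ G_T(s_n,i,s'),$$ where for $n=0$ the hypothesis is empty and $s_0 = s$. $\mathsf{BaseCheck}(n)$ is the statement $\exists s.\ G_I(s) \land \mathsf{Viable}_n(s)$, and $\mathsf{ExtendCheck}(n)$ is the statement $\forall s.\ \mathsf{Extend}_n(s)$. *)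

(* Defs.v *)
(* Standard library only. *)
From Stdlib Require Import List.

Set Implicit Arguments.
Unset Strict Implicit.

Record transition_system (state input : Type) := TransitionSystem {
  init : state -> Prop;
  trans : state -> input -> state -> Prop
}.

Record contract (state input : Type) := Contract {
  assumption : state -> input -> Prop;
  init_guarantee : state -> Prop;
  trans_guarantee : state -> input -> state -> Prop
}.

Inductive Reachable (state input : Type) (S : transition_system state input)
    (A : state -> input -> Prop) : state -> Prop :=
| Reachable_init : forall s, init S s -> Reachable S A s
| Reachable_step : forall sp i s,
    Reachable S A sp -> A sp i -> trans S sp i s -> Reachable S A s.

Definition realization (state input : Type) (S : transition_system state input)
    (C : contract state input) : Prop :=
  (forall s, init S s -> init_guarantee C s) /\
  (forall s i s',
     Reachable S (assumption C) s /\ assumption C s i /\ trans S s i s' ->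
     trans_guarantee C s i s') /\
  (exists s, init S s) /\
  (forall s i,
     Reachable S (assumption C) s /\ assumption C s i ->
     exists s', trans S s i s').

Definition realizable (state input : Type) (C : contract state input) : Prop :=
  exists S : transition_system state input, realization S C.

Fixpoint Viable (state input : Type) (C : contract state input) (n : nat)
    (s : state) : Prop :=
  match n with
  | 0 => True
  | S m => forall i, assumption C s i ->
             exists s', trans_guarantee C s i s' /\ Viable C m s'
  end.

(* The list (i_1, s_1) :: ... :: (i_n, s_n) :: nil encodes a path of length n
   from s = s_0. *)
Fixpoint valid_path (state input : Type) (C : contract state input) (s : state)
    (p : list (input * state)) : Prop :=
  match p with
  | nil => True
  | (i, s') :: q =>
      assumption C s i /\ trans_guarantee C s i s' /\ valid_path C s' q
  end.

(* The default value s makes this s_0 = s on the empty path. *)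
Definition path_end (state input : Type) (s : state) (p : list (input * state))
    : state :=
  last (map snd p) s.

Definition Extend (state input : Type) (C : contract state input) (n : nat)
    (s : state) : Prop :=
  forall p : list (input * state), length p = n -> valid_path C s p ->
  forall i, assumption C (path_end s p) i ->
  exists s', trans_guarantee C (path_end s p) i s'.

Definition BaseCheck (state input : Type) (C : contract state input) (n : nat)
    : Prop :=
  exists s, init_guarantee C s /\ Viable C n s.

Definition ExtendCheck (state input : Type) (C : contract state input) (n : nat)
    : Prop :=
  forall s, Extend C n s.

(* Main.v *)
(* One-step extension upgrades viability for [n] steps to viability for [n + 1]
   steps.  Hence, from a state that is viable for [n] steps, every valid input can
   be answered by a move to another state that is viable for [n] steps, and the
   system that makes exactly these moves is a realization. *)
From Stdlib Require Import List.
Require Import Defs.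

Lemma path_end_cons (state input : Type) (s s' : state) (i : input)
    (p : list (input * state)) :
  path_end s ((i, s') :: p) = path_end s' p.
Proof.
  unfold path_end; simpl; generalize (map snd p) as l; intro l.
  revert s s'; induction l as [|t l IH]; intros s s'; [reflexivity|].
  simpl in *; rewrite (IH s t), (IH s' t); reflexivity.
Qed.

(** Prepending the step [(i, s')] to a path of length [n] from [s'] gives one of length [S n] from
    [s] with the same end. *)
Lemma Extend_tail (state input : Type) (C : contract state input) (n : nat)
    (s s' : state) (i : input) :
  assumption C s i -> trans_guarantee C s i s' ->
  Extend C (S n) s -> Extend C n s'.
Proof.
  intros HA HG HE p Hp Hv.
  rewrite <- (path_end_cons _ _ s s' i p).
  apply HE; simpl; auto.
Qed.

(** The [n] moves granted by viability form a valid path, and [Extend] adds one more move at its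
    end. *)
Lemma Viable_succ (state input : Type) (C : contract state input) (n : nat) :
  forall s, Viable C n s -> Extend C n s -> Viable C (S n) s.
Proof.
  induction n as [|n IH]; intros s HV HE i HA.
  - destruct (HE nil eq_refl I i HA) as [s' HG].
    exists s'; simpl; auto.
  - destruct (HV i HA) as [s' [HG HV']].
    exists s'; split; [exact HG|].
    exact (IH s' HV' (Extend_tail _ _ _ _ _ _ _ HA HG HE)).
Qed.

Theorem theorem3 (state input : Type) (C : contract state input)
    (h : exists n : nat, BaseCheck C n /\ ExtendCheck C n) :
  realizable C.
Proof.
  destruct h as [n [[s0 [HI0 HV0]] HE]].
  pose (T := TransitionSystem
    (fun s => init_guarantee C s /\ Viable C n s)
    (fun s i s' => trans_guarantee C s i s' /\ Viable C n s')).
  assert (HR : forall s, Reachable T (assumption C) s -> Viable C n s).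
  (* Both [init T] and [trans T] carry viability, so case analysis suffices. *)
  { intros s [t [_ HV] | sp i t _ _ [_ HV]]; exact HV. }
  exists T; repeat split.
  - intros s [HI _]; exact HI.
  - intros s i s' [_ [_ [HG _]]]; exact HG.
  - exists s0; split; assumption.
  - intros s i [Hs HA].
    (* [Viable C (S n) s] at input [i] unfolds to the existence of a [T]-successor. *)
    exact (Viable_succ _ _ C n s (HR s Hs) (HE s) i HA).
Qed.
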